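(* Assume $c_\star>2$. There is an event $\Omega'\subset\Omega$ with $\mathbb P(\Omega')=1$ such that for all $0<t<\infty$, any constant $c_\circ>0$ and any sequence $a_n>0$, on $\Omega'$, for all but a finite number of indices $n$, $$P\Big(1\le k_n^\dagger(t)/k_n^\circ(t)\le 1+n^{-c_\circ}\Big)\ge 1-n^{-2(c_\star-1)+c_\circ}\big(1+\mathcal O(n^{-(c_\star-1)})\big).$$
   Context: Let $\mathcal V_n=\{-1,1\}^n$, $\mathcal E_n$ the nearest-neighbour edges ($x,y$ differing in exactly one coordinate). Let $(g(x))_{x\in\mathcal V_n}$, $n\ge1$, be i.i.d. standard Gaussians on $(\Omega,\mathcal F,\mathbb P)$. Given $c_\star>0$, $u_n$ satisfies $\mathbb P(g(x)\le-u_n)=n^{-c_\star}$; $H_n(x)=\sqrt n g(x)$ if $g(x)\le-u_n$, else $0$; $\beta>0$. Call $x$ occupied if $g(x)\le-u_n$; $I_n^\star$ = occupied vertices with no occupied neighbour; $\mathcal V_n^\star$ = occupied vertices not in $I_n^\star$; $\mathcal V_n^\circ=\mathcal V_n\setminus\mathcal V_n^\star$. $J_n$ is the Markov chain on $\mathcal V_n$ with $p_n(x,y)=e^{-\beta[H_n(y)-H_n(x)]^+}/\sum_{y':(x,y')\in\mathcal E_n}e^{-\beta[H_n(y')-H_n(x)]^+}$ on edges and $0$ otherwise, started from the uniform distribution on $\mathcal V_n^\circ$; $P$ is its law given the environment. Let $k_n^\circ(t)=\lfloor a_nt\rfloor$, $K_n(t)=\min\{k\ge1:\sum_{i=0}^{k-1}\mathbb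 1_{\{J_n(i)\in\mathcal V_n^\circ\}}=\lfloor a_nt\rfloor\}$, and $k_n^\dagger(t)=\lfloor a_nt\rfloor+\#\{1\le i\le K_n(t)-1: J_n(i-1)\in\mathcal V_n^\circ,\,J_n(i)\in\mathcal V_n^\star\}$ (the number of steps of the chain obtained by observing $J_n$ at its visits to $\mathcal V_n^\circ$ and at its entrance times into $\mathcal V_n^\star$, needed to make $\lfloor a_nt\rfloor$ visits to $\mathcal V_n^\circ$). *)

(* Defs.v *)
From HB Require Import structures.
From mathcomp Require Import all_boot all_order all_algebra.
From mathcomp Require Import all_classical all_reals all_analysis.
Set Implicit Arguments. Unset Strict Implicit. Unset Printing Implicit Defensive.
Import Order.TTheory GRing.Theory Num.Theory.
Local Open Scope classical_set_scope.
Local Open Scope ring_scope.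

(* Vertices of the hypercube {-1,1}^n, coordinates encoded as booleans. *)
Definition vertex (n : nat) := {ffun 'I_n -> bool}.

Definition nbr {n : nat} (x y : vertex n) : bool := #|[set i | x i != y i]| == 1%N.

Definition gindex := {n : nat & vertex n}.

Section Env.
Context {R : realType} {d : measure_display} {Omega : measurableType d}.

Definition std_gaussian (P : probability Omega R) (X : Omega -> R) : Prop :=
  measurable_fun setT X /\
  forall B : set R, measurable B -> P (X @^-1` B) = normal_prob 0 1 B.

Definition iid_std_gaussian (P : probability Omega R)
    (g : forall n, vertex n -> Omega -> R) : Prop :=
  (forall n (x : vertex n), std_gaussian P (g n x)) /\
  forall (s : seq gindex), uniq s ->
  forall B : gindex -> set R, (forall i, measurable (B i)) ->
    P (\bigcap_(i in [set` s]) ((g (projT1 i) (projT2 i)) @^-1` B i)) =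
    (\prod_(i <- s) P ((g (projT1 i) (projT2 i)) @^-1` B i))%E.
End Env.

Section Landscape.
Context {R : realType} (n : nat) (u beta : R) (gv : vertex n -> R).
(* gv = the environment (g(x))_{x in V_n} evaluated at a fixed omega *)

Definition occupied (x : vertex n) : bool := gv x <= - u.
Definition Vstar (x : vertex n) : bool :=
  occupied x && [exists y, nbr x y && occupied y].
Definition Vcirc (x : vertex n) : bool := ~~ Vstar x.

Definition Hn (x : vertex n) : R :=
  if occupied x then Num.sqrt (n%:R) * gv x else 0.

Definition pweight (x y : vertex n) : R :=
  expR (- (beta * Num.max (Hn y - Hn x) 0)).

Definition ptrans (x y : vertex n) : R :=
  if nbr x y then pweight x y / (\sum_(y' | nbr x y') pweight x y') else 0.

Definition init_circ (x : vertex n) : R :=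
  if Vcirc x then (#|[set y | Vcirc y]|%:R)^-1 else 0.
End Landscape.

Definition is_markov_chain {R : realType} {n : nat} {d2 : measure_display}
    {Omega2 : measurableType d2} (Q : probability Omega2 R)
    (J : nat -> Omega2 -> vertex n) (mu : vertex n -> R)
    (p : vertex n -> vertex n -> R) : Prop :=
  (forall k (x : vertex n), measurable [set w | J k w = x]) /\
  forall (k : nat) (xs : nat -> vertex n),
    Q [set w | forall i, (i <= k)%N -> J i w = xs i] =
    (mu (xs 0%N) * \prod_(i < k) p (xs i) (xs i.+1))%:E.

Section Times.
Context {n : nat} {T : Type} (circ star : pred (vertex n)) (J : nat -> T -> vertex n).

Definition visits_circ (w : T) (k : nat) : nat :=
  count (fun i => circ (J i w)) (iota 0 k).

Definition is_Kn (m : nat) (w : T) (K : nat) : Prop :=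
  (1 <= K)%N /\ visits_circ w K = m /\
  forall k, (1 <= k)%N -> (k < K)%N -> visits_circ w k <> m.

Definition kdagger (m : nat) (w : T) (K : nat) : nat :=
  (m + count (fun i => circ (J i.-1 w) && star (J i w)) (iota 1 K.-1))%N.
End Times.

(* Main.v *)
(* The chain is reversible with respect to pi(x) = sum_(y ~ x) exp(-beta max(H x, H y)) / n,
   which equals 1 on Vcirc because every edge touching Vcirc has an unoccupied end. So
   the initial law is pi conditioned on Vcirc, each of the successive visits to Vcirc is
   uniform there, and the expected number of entrances into Vstar during the first m
   visits is at most m #|Vstar| / #|Vcirc|; Markov's inequality bounds the probability
   that it exceeds m n^(-ccirc).
   In the environment, #|Vstar| is at most the number of ordered pairs of adjacent
   occupied vertices. For each coordinate i the pairs (x, flip i x) form a perfect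
   matching, so a second moment bound shows that there are more than half of
   2^n n^2 n^(-2 cstar) such pairs with probability O(n^-2). By Borel-Cantelli, almost
   surely #|Vstar| / #|Vcirc| <= n^(-2 (cstar - 1)) eventually, and C = 0 works. *)

Require Import Defs.
From HB Require Import structures.
From mathcomp Require Import all_boot all_order all_algebra.
From mathcomp Require Import all_classical all_reals all_analysis.
From mathcomp Require Import measurable_realfun.
From mathcomp Require Import ring lra.
Import Order.TTheory GRing.Theory Num.Theory.
Local Open Scope classical_set_scope.
Local Open Scope ring_scope.

(** * Finite sums of indicators and finite partitions *)

Lemma sum_measure_indic {d} {T : measurableType d} {R : realType}
    (Q : probability T R) (I : finType) (A : I -> set T) :
  (forall i, measurable (A i)) ->
  (\sum_i Q (A i) = \int[Q]_w (\sum_i (\1_(A i) w)%:E))%E.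
Proof.
move=> mA; rewrite ge0_integral_sum//.
- by apply: eq_bigr => i _; rewrite integral_indic// setIT.
- by move=> i; apply/measurable_EFinP; exact: measurable_indic.
Qed.

(** Markov's inequality for a counting variable. It serves twice: for entrances of the chain and for
    pairs in the environment. *)
Lemma markov_indic {d} {T : measurableType d} {R : realType}
    (Q : probability T R) (I : finType) (A : I -> set T) (c : R) :
  (forall i, measurable (A i)) -> 0 <= c ->
  measurable [set w | (c <= \sum_i \1_(A i) w)%R] /\
  (c%:E * Q [set w | (c <= \sum_i \1_(A i) w)%R] <= \sum_i Q (A i))%E.
Proof.
move=> mA c0; set E := [set w | _].
have mf : measurable_fun setT (fun w => \sum_i (\1_(A i) w : R)).
  apply: measurable_sum => i; exact: measurable_indic.
have mE : measurable E.
  by rewrite -[E]setTI; apply: (@measurable_fun_le _ T R setT (cst c)).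
split => //; rewrite sum_measure_indic//.
have -> : (Q E = \int[Q]_w (\1_E w)%:E)%E by rewrite integral_indic// setIT.
rewrite -ge0_integralZl_EFin//; last first.
  by apply/measurable_EFinP; exact: measurable_indic.
apply: ge0_le_integral => //.
- by move=> x _; rewrite -EFinM lee_fin mulr_ge0.
- apply/measurable_EFinP/measurable_funM => //; exact: measurable_indic.
- by apply: emeasurable_sum => i; apply/measurable_EFinP; exact: measurable_indic.
- move=> x _; rewrite sumEFin -EFinM lee_fin indicE.
  case: (boolP (x \in E)) => xE; last by rewrite mulr0 sumr_ge0.
  by rewrite mulr1; move: xE; rewrite inE.
Qed.

Lemma measure_finite_partition {d} {T : measurableType d} {R : realType}
    (Q : probability T R) (F : finType) (X : T -> F) (B : set T) :
  measurable B -> (forall f, measurable [set w | X w = f]) ->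
  Q B = (\sum_f Q (B `&` [set w | X w = f]))%E.
Proof.
move=> mB mX; rewrite sum_measure_indic//; last by move=> f; exact: measurableI.
rewrite -[in LHS](setIT B) -integral_indic//.
apply: eq_integral => w _; rewrite sumEFin; congr EFin.
rewrite (bigD1 (X w))//= big1 => [|f fX].
  rewrite addr0 !indicE; congr (_%:R); congr nat_of_bool.
  by apply/idP/idP; rewrite !inE => // -[].
rewrite indicE memNset// => -[_] /= e; by rewrite e eqxx in fX.
Qed.

(** * Markov chains on the hypercube *)

Section markov_chain_paths.
Context {R : realType} {n : nat} {d2 : measure_display}
  {Omega2 : measurableType d2} (Q : probability Omega2 R)
  (J : nat -> Omega2 -> vertex n) (mu : vertex n -> R)
  (p : vertex n -> vertex n -> R).
Hypothesis MC : is_markov_chain Q J mu p.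

(** Stands for membership in the sigma-algebra of the states up to time [k]; the state space being
    finite, such an event is a finite union of path cylinders. *)
Definition depends_upto (k : nat) (A : set (nat -> vertex n)) :=
  forall v v', (forall i, (i <= k)%N -> v i = v' i) -> A v -> A v'.

Definition trajectory (w : Omega2) : nat -> vertex n := fun i => J i w.

Definition initial_segment (k : nat) (w : Omega2) : {ffun 'I_k.+1 -> vertex n} :=
  [ffun i : 'I_k.+1 => J i w].

Lemma initial_segmentP k w (f : {ffun 'I_k.+1 -> vertex n}) :
  initial_segment k w = f <-> forall i, (i <= k)%N -> J i w = f (inord i).
Proof.
split=> [<- i ik|H]; first by rewrite ffunE inordK.
by apply/ffunP => i; rewrite ffunE H ?inord_val// -ltnS.
Qed.

Lemma measurable_initial_segment k f :
  measurable [set w | initial_segment k w = f].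
Proof.
rewrite (_ : [set _ | _] =
    \bigcap_(i in `I_k.+1) [set w | J i w = f (inord i)]).
  by apply: fin_bigcap_measurable => // i _; exact: (proj1 MC).
by apply/seteqP; split=> w /= /initial_segmentP H.
Qed.

Lemma measurable_depends_upto k A : depends_upto k A ->
  measurable [set w | A (trajectory w)].
Proof.
move=> dA.
rewrite (_ : [set _ | _] = \bigcup_(f in [set f : {ffun 'I_k.+1 -> vertex n} |
    A (fun i => f (inord i))]) [set w | initial_segment k w = f]).
  apply: fin_bigcup_measurable => [|f _]; first exact: finite_finset.
  exact: measurable_initial_segment.
apply/seteqP; split=> [w Aw|w [f Af /initial_segmentP wf]].
  exists (initial_segment k w) => //=.
  by apply: dA Aw => i ik; rewrite ffunE inordK.
by apply: dA Af => i ik; rewrite /trajectory wf.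
Qed.

(** Both events split over initial segments. On each segment the path formula applies, and the two
    paths differ by the single factor [p x y]. *)
Lemma markov_property k A x y : depends_upto k A ->
  fine (Q [set w | A (trajectory w) /\ J k w = x /\ J k.+1 w = y]) =
  fine (Q [set w | A (trajectory w) /\ J k w = x]) * p x y.
Proof.
move=> dA.
have mA2 : measurable [set w | A (trajectory w) /\ J k w = x].
  by apply: measurableI; [exact: measurable_depends_upto dA|exact: (proj1 MC)].
have mA3 : measurable [set w | A (trajectory w) /\ J k w = x /\ J k.+1 w = y].
  apply: measurableI; first exact: measurable_depends_upto dA.
  by apply: measurableI; exact: (proj1 MC).
rewrite (measure_finite_partition Q _ _ _ mA3 (@measurable_initial_segment k)).
rewrite (measure_finite_partition Q _ _ _ mA2 (@measurable_initial_segment k)).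
rewrite -!sum_fine; last 2 first.
- move=> f _; apply: fin_num_measure; apply: measurableI => //.
  exact: measurable_initial_segment.
- move=> f _; apply: fin_num_measure; apply: measurableI => //.
  exact: measurable_initial_segment.
rewrite mulr_suml; apply: eq_bigr => f _.
(* A segment that violates [A] or does not end at [x] contributes 0 to both sides; the free [B]
   treats the events with and without the last step together. *)
case: (pselect (A (fun i => f (inord i)) /\ f ord_max = x)) => [[Af fx]|nAf]; last first.
  suff H B : [set w | A (trajectory w) /\ J k w = x /\ B w] `&` [set w | initial_segment k w = f] = set0.
    rewrite H; have := H (fun=> True).
    rewrite (_ : [set w | _ /\ _ /\ True] = [set w | A (trajectory w) /\ J k w = x]).
      by move=> ->; rewrite !measure0 /= mul0r.
    by apply/seteqP; split=> [w [? []]|w []].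
  rewrite -subset0 => w [[Aw [wx _]] /initial_segmentP wf]; apply: nAf; split.
    by apply: dA Aw => i ik; rewrite /trajectory wf.
  by rewrite -wx (wf k (leqnn k)); congr (f _); apply: val_inj; rewrite /= inordK.
pose xs i := if (i <= k)%N then f (inord i) else y.
have -> : [set w | A (trajectory w) /\ J k w = x /\ J k.+1 w = y] `&`
    [set w | initial_segment k w = f] =
    [set w | forall i, (i <= k.+1)%N -> J i w = xs i].
  apply/seteqP; split=> [w [[Aw [wx wy]] /initial_segmentP wf] i|w H].
    rewrite leq_eqVlt => /orP[/eqP ->|]; first by rewrite /xs ltnn.
    by rewrite ltnS => ik; rewrite /xs ik wf.
  have wf i : (i <= k)%N -> J i w = f (inord i).
    by move=> ik; rewrite H ?leqW// /xs ik.
  have wx : J k w = x by rewrite wf// -fx; congr (f _); apply: val_inj; rewrite /= inordK.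
  split; last exact/initial_segmentP.
  split; first by apply: dA Af => i ik; rewrite /trajectory wf.
  by split=> //; rewrite H// /xs ltnn.
have -> : [set w | A (trajectory w) /\ J k w = x] `&`
    [set w | initial_segment k w = f] =
    [set w | forall i, (i <= k)%N -> J i w = xs i].
  apply/seteqP; split=> [w [_ /initial_segmentP wf] i ik|w H].
    by rewrite /xs ik wf.
  have wf i : (i <= k)%N -> J i w = f (inord i).
    by move=> ik; rewrite H // /xs ik.
  have wx : J k w = x by rewrite wf// -fx; congr (f _); apply: val_inj; rewrite /= inordK.
  split; last exact/initial_segmentP.
  by split=> //; apply: dA Af => i ik; rewrite /trajectory wf.
rewrite !(proj2 MC) /= big_ord_recr /= mulrA; congr (_ * p _ _).
  by rewrite /xs leqnn -fx; congr (f _); apply: val_inj; rewrite /= inordK.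
by rewrite /xs ltnn.
Qed.

End markov_chain_paths.

Lemma visits_circS {n : nat} {T : Type} (circ : pred (vertex n))
    (J : nat -> T -> vertex n) (w : T) k :
  visits_circ circ J w k.+1 = (visits_circ circ J w k + circ (J k w))%N.
Proof. by rewrite /visits_circ -addn1 iotaD count_cat /= addn0. Qed.

Lemma leq_visits_circ {n : nat} {T : Type} (circ : pred (vertex n))
    (J : nat -> T -> vertex n) (w : T) k l :
  (k <= l)%N -> (visits_circ circ J w k <= visits_circ circ J w l)%N.
Proof.
move=> /subnK <-; elim: (l - k)%N => // j IH; rewrite addSn visits_circS.
exact: leq_trans IH (leq_addr _ _).
Qed.

(** * Expected occupation times up to a given number of visits *)

Section occupation.
Context {R : realType} {n : nat} {d2 : measure_display}
  {Omega2 : measurableType d2} (Q : probability Omega2 R)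
  (J : nat -> Omega2 -> vertex n) (mu : vertex n -> R)
  (p : vertex n -> vertex n -> R) (circ : pred (vertex n)).
Hypothesis MC : is_markov_chain Q J mu p.

Lemma visits_circ_eq_upto k (v v' : nat -> vertex n) :
  (forall i, (i <= k)%N -> v i = v' i) ->
  visits_circ circ (fun i v => v i) v k = visits_circ circ (fun i v => v i) v' k.
Proof.
move=> vv'; apply: eq_in_count => i; rewrite mem_iota add0n => /= ik.
by rewrite vv'// ltnW.
Qed.

Lemma depends_upto_visits k m :
  depends_upto k (fun v => (visits_circ circ (fun i v => v i) v k < m)%N).
Proof. by move=> v v' vv'; rewrite (visits_circ_eq_upto k v v'). Qed.

(** [visits_circ] at [i] counts times before [i] only. Summed over [i], this is the expected time
    spent at [x] up to and including the [m]-th visit to [circ]. *)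
Definition occupation (i m : nat) (x : vertex n) : R :=
  fine (Q [set w | (visits_circ circ J w i < m)%N /\ J i w = x]).

Lemma markov_init x : Q [set w | J 0%N w = x] = (mu x)%:E.
Proof.
have := proj2 MC 0%N (fun=> x); rewrite big_ord0 mulr1 => <-.
by congr (Q _); apply/seteqP; split=> [w /= wx i|w /(_ 0%N (leqnn _))//]; rewrite leqn0 => /eqP ->.
Qed.

Lemma occupation0 i x : occupation i 0 x = 0.
Proof.
rewrite /occupation (_ : [set _ | _] = set0) ?measure0//.
by rewrite -subset0 => w [].
Qed.

Lemma occupation_start m x : occupation 0 m.+1 x = mu x.
Proof.
rewrite /occupation (_ : [set _ | _] = [set w | J 0%N w = x]) ?markov_init//.
by apply/seteqP; split=> w [].
Qed.

(** Conditioning on the state at time [i]: being in [circ] there uses up one of the allowed visits,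
    which lowers the budget from [m.+1] to [m]. *)
Lemma occupation_step i m y :
  occupation i.+1 m.+1 y =
  \sum_x occupation i (if circ x then m else m.+1) x * p x y.
Proof.
rewrite /occupation.
have mE : measurable [set w | (visits_circ circ J w i.+1 < m.+1)%N /\ J i.+1 w = y].
  apply: measurableI; last exact: (proj1 MC).
  exact: (measurable_depends_upto _ _ _ _ MC _ _ (depends_upto_visits i.+1 m.+1)).
rewrite (measure_finite_partition Q _ (J i) _ mE) => [|f]; last exact: (proj1 MC).
rewrite -sum_fine => [|x _]; last first.
  by apply: fin_num_measure; apply: measurableI => //; exact: (proj1 MC).
apply: eq_bigr => x _.
rewrite -(markov_property _ _ _ _ MC i _ x y
  (depends_upto_visits i (if circ x then m else m.+1))).
congr (fine (Q _)); apply/seteqP; split=> w /=.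
  by move=> [[+ wy] wx]; rewrite visits_circS wx; case: (circ x) => /=;
    rewrite ?addn1 ?addn0 ?ltnS.
by move=> [+ [wx wy]]; rewrite visits_circS wx; case: (circ x) => /=;
    rewrite ?addn1 ?addn0 ?ltnS.
Qed.

Variables (pi : vertex n -> R) (kappa : R).
Hypotheses (kappa0 : 0 <= kappa) (p0 : forall x y, 0 <= p x y)
  (pi0 : forall x, 0 <= pi x)
  (piP : forall y, \sum_x pi x * p x y = pi y)
  (mu_circ : forall x, mu x = if circ x then kappa * pi x else 0).

(* Started from the invariant measure conditioned on [circ], the chain watched
   on [circ] is stationary; only the inequality is needed, and it follows by
   induction on the time horizon. *)
Lemma occupation_le L m x :
  \sum_(i < L) occupation i m.+1 x <= (m%:R + (circ x)%:R) * kappa * pi x.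
Proof.
elim: L m x => [|L IH] m y.
  by rewrite big_ord0 !mulr_ge0// addr_ge0.
rewrite big_ord_recl occupation_start.
under eq_bigr do rewrite lift0 occupation_step.
rewrite exchange_big/=.
under eq_bigr do rewrite -mulr_suml.
(* On [circ] the lowered budget gives (m - 1) + 1, off [circ] it gives m + 0. The common bound is a
   multiple of [pi], so invariance applies, and [mu y] supplies the extra term on [circ]. *)
have le_circ x : \sum_(i < L) occupation i (if circ x then m else m.+1) x
    <= m%:R * kappa * pi x.
  case: ifPn => cx; last by have := IH m x; rewrite (negbTE cx) addr0.
  case: m => [|m]; first by rewrite big1 ?mul0r// => i _; exact: occupation0.
  by have := IH m x; rewrite cx -natrD addn1.
apply: (@le_trans _ _ (mu y + \sum_x m%:R * kappa * pi x * p x y)).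
  by rewrite lerD2l; apply: ler_sum => x _; exact: ler_wpM2r.
under eq_bigr do rewrite -mulrA.
rewrite -mulr_sumr piP mu_circ; case: (circ y).
  by rewrite addrC -[X in _ + X](mul1r) -!mulrA -mulrDl mulrA.
by rewrite add0r addr0.
Qed.

End occupation.

(** * Entrances into [star] during the first [m] visits to [circ] *)

Section entrances.
Context {R : realType} {n : nat} {d2 : measure_display}
  {Omega2 : measurableType d2} (Q : probability Omega2 R)
  (J : nat -> Omega2 -> vertex n) (mu : vertex n -> R)
  (p : vertex n -> vertex n -> R) (circ star : pred (vertex n)).
Hypothesis MC : is_markov_chain Q J mu p.

Definition early_entrance (m i : nat) : set Omega2 :=
  [set w | [&& (visits_circ circ J w i < m)%N, circ (J i w) & star (J i.+1 w)]].

(** The visit budget [m] replaces the random time K, and the deterministic horizon [L] keeps every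
    event dependent on finitely many states. *)
Definition early_entrances (m L : nat) (w : Omega2) : nat :=
  count (fun i => [&& (visits_circ circ J w i < m)%N, circ (J i w)
                    & star (J i.+1 w)]) (iota 0 L).

Lemma measurable_early_entrance m i : measurable (early_entrance m i).
Proof.
apply: (measurable_depends_upto _ _ _ _ MC i.+1
  (fun v => [&& (visits_circ circ (fun i v => v i) v i < m)%N, circ (v i)
    & star (v i.+1)])) => v v' vv'.
rewrite (visits_circ_eq_upto circ i v v') => [|j ji]; last by rewrite vv'// leqW.
by rewrite !vv'.
Qed.

Lemma early_entrances_indic m L w :
  (early_entrances m L w)%:R = \sum_(i < L) \1_(early_entrance m i) w :> R.
Proof.
rewrite /early_entrances -sum1_count -[L in iota 0 L](subn0 L) big_mkord.
rewrite natr_sum big_mkcond /=; apply: eq_bigr => i _.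
by rewrite indicE; case: ifP => H; [rewrite mem_set|rewrite memNset// /early_entrance /= H].
Qed.

Lemma prob_early_entrance m i :
  fine (Q (early_entrance m i)) =
  \sum_(x | circ x) \sum_(y | star y) occupation Q J circ i m x * p x y.
Proof.
rewrite (measure_finite_partition Q _ (fun w => (J i w, J i.+1 w)) _
  (measurable_early_entrance m i)) => [|[x y]]; last first.
  rewrite (_ : [set _ | _] = [set w | J i w = x] `&` [set w | J i.+1 w = y]).
    by apply: measurableI; exact: (proj1 MC).
  by apply/seteqP; split=> w /= [-> ->].
rewrite -sum_fine => [|[x y] _]; last first.
  apply: fin_num_measure; apply: measurableI; first exact: measurable_early_entrance.
  rewrite (_ : [set _ | _] = [set w | J i w = x] `&` [set w | J i.+1 w = y]).
    by apply: measurableI; exact: (proj1 MC).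
  by apply/seteqP; split=> w /= [-> ->].
rewrite pair_big_dep /= [RHS]big_mkcond /=; apply: eq_bigr => -[x y] _ /=.
rewrite -(markov_property _ _ _ _ MC i _ x y (depends_upto_visits circ i m)).
case: ifPn => [/andP[cx sy]|nc].
  congr (fine (Q _)); apply/seteqP; split=> w /=.
    by move=> [/and3P[vm _ _] [wx wy]].
  by move=> [vm [wx wy]]; rewrite /early_entrance /= wx wy cx sy vm.
rewrite (_ : _ `&` _ = set0) ?measure0//.
rewrite -subset0 => w /= [/and3P[_ + +] [wx wy]]; rewrite wx wy => cx sy.
by rewrite cx sy in nc.
Qed.

Variables (pi : vertex n -> R) (kappa rho : R).
Hypotheses (kappa0 : 0 <= kappa) (p0 : forall x y, 0 <= p x y)
  (pi0 : forall x, 0 <= pi x)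
  (piP : forall y, \sum_x pi x * p x y = pi y)
  (mu_circ : forall x, mu x = if circ x then kappa * pi x else 0)
  (flux : \sum_(x | circ x) \sum_(y | star y) kappa * pi x * p x y <= rho).

(** By [occupation_le], each [x] in [circ] is occupied for an expected time of at most
    [m * kappa * pi x], so the flux [rho] is paid at most [m] times, uniformly in [L]. *)
Lemma expected_early_entrances m L :
  (\sum_(i < L) Q (early_entrance m i) <= (m%:R * rho)%:E)%E.
Proof.
rewrite -EFin_sum_fine => [|i _]; last first.
  by apply: fin_num_measure; exact: measurable_early_entrance.
rewrite lee_fin; under eq_bigr do rewrite prob_early_entrance.
rewrite exchange_big /=.
apply: (@le_trans _ _ (m%:R *
    \sum_(x | circ x) \sum_(y | star y) kappa * pi x * p x y)); last exact: ler_wpM2l.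
rewrite mulr_sumr; apply: ler_sum => x cx; rewrite exchange_big /= mulr_sumr.
apply: ler_sum => y _; rewrite -mulr_suml mulrA; apply: ler_wpM2r => //.
case: m => [|m]; first by rewrite big1 ?mul0r// => i _; exact: occupation0.
rewrite mulrA.
have := occupation_le _ _ _ _ _ MC _ _ kappa0 p0 pi0 piP mu_circ L m x.
by rewrite cx -natrD addn1.
Qed.

Lemma early_entrances_tail m L eps : 0 < eps ->
  measurable [set w | eps * m%:R < (early_entrances m L w)%:R] /\
  (Q [set w | (eps * m%:R < (early_entrances m L w)%:R)%R] <= (rho / eps)%:E)%E.
Proof.
move=> eps0.
have rho0 : 0 <= rho.
  apply: le_trans flux; apply: sumr_ge0 => x _; apply: sumr_ge0 => y _.
  by rewrite !mulr_ge0.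
(* For [m = 0] the level in Markov's inequality would vanish, but then no entrance is counted and
   the strict inequality fails. *)
case: m => [|m].
  rewrite (_ : [set _ | _] = set0); first by rewrite measure0 lee_fin divr_ge0// ltW.
  rewrite -subset0 => w /=; rewrite mulr0 /early_entrances.
  by rewrite (eq_count (a2 := pred0)) ?count_pred0 ?ltxx.
have em0 : 0 < eps * m.+1%:R by rewrite mulr_gt0.
have mE : measurable [set w | eps * m.+1%:R < (early_entrances m.+1 L w)%:R].
  apply: (measurable_depends_upto _ _ _ _ MC L (fun v => eps * m.+1%:R <
    (count (fun i => [&& (visits_circ circ (fun i v => v i) v i < m.+1)%N,
       circ (v i) & star (v i.+1)]) (iota 0 L))%:R)) => v v' vv'.
  rewrite (eq_in_count (a2 := (fun i => [&& (visits_circ circ (fun i v => v i) v' i < m.+1)%N,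
       circ (v' i) & star (v' i.+1)]))) => [//|i].
  rewrite mem_iota add0n => /= iL.
  rewrite (visits_circ_eq_upto circ i v v') => [|j ji]; first by rewrite !vv'// ltnW.
  by rewrite vv'//; exact: leq_trans ji (ltnW iL).
split=> //.
have [mE' le_exp] := markov_indic Q _ (fun i : 'I_L => early_entrance m.+1 i)
  (eps * m.+1%:R) (fun i => measurable_early_entrance m.+1 i) (ltW em0).
have le_rho := le_trans le_exp (expected_early_entrances m.+1 L).
rewrite -(@lee_pmul2l _ (eps * m.+1%:R)%:E)//.
rewrite -EFinM (_ : eps * m.+1%:R * (rho / eps) = m.+1%:R * rho); last first.
  by field; rewrite lt0r_neq0.
apply: le_trans le_rho; rewrite lee_pmul2l//.
by apply: le_measure; rewrite ?inE// => w /=; rewrite early_entrances_indic => /ltW.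
Qed.

(** K is the first time at which the visit count reaches [m], so every entrance before K satisfies
    the budget condition. *)
Lemma kdagger_early_entrances m w K : circ (J 0%N w) -> is_Kn circ J m w K ->
  kdagger circ star J m w K = (m + early_entrances m K.-1 w)%N.
Proof.
move=> c0 [K1 [vK minK]]; congr addn.
rewrite -[1%N]addn0 iotaDl count_map; apply: eq_in_count => i.
rewrite mem_iota add0n => /= iK; rewrite add1n /=.
suff -> : (visits_circ circ J w i < m)%N by [].
have iK' : (i < K)%N by rewrite (leq_trans iK)// leq_pred.
rewrite ltn_neqAle -{2}vK leq_visits_circ ?andbT; last exact: ltnW.
(* Minimality of K covers only indices at least 1. At index 0 the start in [circ] forces [m] to be
   positive. *)
case: i iK iK' => [|i] iK iK'; last by apply/eqP; exact: minK.
have : (visits_circ circ J w 1 <= m)%N by rewrite -vK leq_visits_circ.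
by rewrite visits_circS c0 addn1; case: (m).
Qed.

(** Up to the null event of a start outside [circ], failure means that some horizon [L] sees more
    than [eps * m] early entrances; the tail bound does not depend on [L]. *)
Lemma kdagger_concentration m eps : 0 < eps ->
  ((1 - rho / eps)%:E <= Q [set w | forall K, is_Kn circ J m w K ->
     (m <= kdagger circ star J m w K)%N /\
     ((kdagger circ star J m w K)%:R <= (1 + eps) * m%:R)%R])%E.
Proof.
move=> eps0; set G := [set w | _].
pose F L := [set w | eps * m%:R < (early_entrances m L w)%:R].
have mF L : measurable (F L) by have [] := early_entrances_tail m L eps eps0.
have mG : measurable G.
  (* For a fixed K the condition depends on the states up to K only, so [G] is a countable
     intersection of measurable sets. *)
  rewrite (_ : G = \bigcap_K [set w | is_Kn circ J m w K ->
     (m <= kdagger circ star J m w K)%N /\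
     ((kdagger circ star J m w K)%:R <= (1 + eps) * m%:R)%R]).
    apply: bigcapT_measurable => K.
    apply: (measurable_depends_upto _ _ _ _ MC K (fun v =>
       is_Kn circ (fun i v => v i) m v K ->
       (m <= kdagger circ star (fun i v => v i) m v K)%N /\
       ((kdagger circ star (fun i v => v i) m v K)%:R <= (1 + eps) * m%:R)%R)).
    move=> v v' vv' H [K1 [vK minK]].
    have vis i : (i <= K)%N -> visits_circ circ (fun i v => v i) v i =
        visits_circ circ (fun i v => v i) v' i.
      move=> iK; apply: visits_circ_eq_upto => j ji; rewrite vv'//.
      exact: leq_trans ji iK.
    rewrite (_ : kdagger _ _ _ _ v' K = kdagger circ star (fun i v => v i) m v K).
      apply: H; split=> //; split; first by rewrite vis.
      by move=> k k1 kK; rewrite vis; [exact: minK|exact: ltnW].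
    congr addn; apply: eq_in_count => i; rewrite mem_iota => /andP[i1 iK].
    have {}iK : (i <= K)%N by rewrite -ltnS (leq_trans iK)// add1n ltnS leq_pred.
    by rewrite !vv'// (leq_trans (leq_pred _)).
  by apply/seteqP; split=> [w Gw K _|w Gw K]; [exact: Gw|exact: (Gw K I)].
pose N0 := [set w | ~~ circ (J 0%N w)].
have mN0 : measurable N0.
  apply: (measurable_depends_upto _ _ _ _ MC 0%N (fun v => ~~ circ (v 0%N))).
  by move=> v v' ->.
have QN0 : Q N0 = 0%E.
  rewrite (measure_finite_partition Q _ (J 0%N) _ mN0) => [|x]; last exact: (proj1 MC).
  apply: big1 => x _; have [cx|/negbTE ncx] := boolP (circ x).
    by rewrite (_ : _ `&` _ = set0) ?measure0// -subset0 /N0 => w /= [+ wx]; rewrite wx cx.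
  have mux : mu x = 0 by rewrite mu_circ ncx.
  apply/eqP; rewrite eq_le measure_ge0 andbT.
  have <- : Q [set w | J 0%N w = x] = 0%E by rewrite (markov_init _ _ _ _ MC) mux.
  apply: le_measure; rewrite ?inE//; [apply: measurableI => //|]; exact: (proj1 MC).
have bad : ~` G `<=` N0 `|` \bigcup_L F L.
  move=> w nG; case: (boolP (circ (J 0%N w))) => c0; last by left.
  right; apply: contrapT => nF; apply: nG => K wK.
  rewrite (kdagger_early_entrances _ _ _ c0 wK); split; first exact: leq_addr.
  rewrite natrD mulrDl mul1r lerD2l leNgt; apply/negP => FK.
  by apply: nF; exists K.-1.
have QF : (Q (\bigcup_L F L) <= (rho / eps)%:E)%E.
  (* Continuity from below along the increasing [F] carries the uniform bound over to the union. *)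
  have ndF : nondecreasing_seq F.
    move=> L L' LL'; apply/subsetPset => w; rewrite /F /= => /lt_le_trans; apply.
    rewrite ler_nat /early_entrances -(subnKC LL') iotaD count_cat.
    exact: leq_addr.
  have cvF := nondecreasing_cvg_mu (mu := Q) mF (bigcupT_measurable _ mF) ndF.
  rewrite -(cvg_lim _ cvF)//; apply: lime_le; first exact: cvgP cvF.
  by apply: nearW => L /=; have [] := early_entrances_tail m L eps eps0.
have mUF := bigcupT_measurable _ mF.
have QGc : (Q (~` G) <= (rho / eps)%:E)%E.
  apply: le_trans (_ : Q (N0 `|` \bigcup_L F L) <= _)%E.
    by apply: le_measure; rewrite ?inE//; [exact: measurableC|exact: measurableU].
  apply: (@le_trans _ _ (Q N0 + Q (\bigcup_L F L))%E); first exact: measureU2.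
  by rewrite QN0 add0e.
rewrite EFinB -(setCK G) probability_setC; last exact: measurableC.
exact: leeB.
Qed.

End entrances.

(** * The landscape at a fixed environment *)

Definition flip {n : nat} (i : 'I_n) (x : vertex n) : vertex n :=
  [ffun j => (j == i) (+) x j].

(* Under [classical_set_scope] the braces in [#|[set x | a x]|] of [nbr] and
   [init_circ] build a classical set, seen as a predicate on [T]. *)
Lemma card_setE (T : finType) (a : pred T) : #|[set x | a x]| = #|a|.
Proof. by apply: eq_card => x; apply/idP/idP; rewrite inE. Qed.

Lemma flip_neq {n : nat} (i : 'I_n) (x : vertex n) : flip i x != x.
Proof.
by apply/eqP => /ffunP /(_ i); rewrite ffunE eqxx; case: (x i).
Qed.

Lemma nbrP {n : nat} (x y : vertex n) : reflect (exists i, y = flip i x) (nbr x y).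
Proof.
rewrite /nbr card_setE; apply: (iffP card1P) => [[i Hi]|[i ->]]; exists i.
  apply/ffunP => j; rewrite ffunE.
  by have <- : (x j != y j) = (j == i) := Hi j; case: (x j); case: (y j).
move=> j; suff : (x j != flip i x j) = (j == i) by [].
by rewrite ffunE; case: (j == i); case: (x j).
Qed.

Lemma nbr_sym {n : nat} (x y : vertex n) : nbr x y = nbr y x.
Proof. by rewrite /nbr !card_setE; congr (_ == _); apply: eq_card => i; exact: (congr1 negb (eq_sym _ _)). Qed.

Lemma big_nbr {R : realType} {n : nat} (x : vertex n) (F : vertex n -> R) :
  \sum_(y | nbr x y) F y = \sum_(i < n) F (flip i x).
Proof.
rewrite -(big_imset (h := fun i => flip i x)) /=.
  by apply: eq_bigl => y; apply/nbrP/imsetP => [[i ->]|[i _ ->]]; exists i.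
move=> i j _ _ /ffunP /(_ i); rewrite !ffunE eqxx.
by case: (i =P j) => //; case: (x i).
Qed.

Section landscape.
Context {R : realType} {n : nat} (u beta : R) (gv : vertex n -> R).
Hypotheses (n_gt0 : (0 < n)%N) (u_ge0 : 0 <= u).

Local Notation H := (Hn u gv).
Local Notation circ := (Vcirc u gv).
Local Notation star := (Vstar u gv).

(** Symmetric edge weights of the random walk on a weighted graph that realizes the Metropolis-type
    chain. *)
Definition conductance (x y : vertex n) : R := expR (- (beta * Num.max (H x) (H y))).

Definition reversible_measure (x : vertex n) : R :=
  (\sum_(y | nbr x y) conductance x y) / n%:R.

Lemma Hn_le0 x : H x <= 0.
Proof.
rewrite /Hn; case: ifPn => // /le_trans gx; rewrite mulr_ge0_le0 ?sqrtr_ge0//.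
by apply: gx; rewrite oppr_le0.
Qed.

Lemma sum_nbr_gt0 (F : vertex n -> R) x :
  (forall y, 0 < F y) -> 0 < \sum_(y | nbr x y) F y.
Proof.
move=> F0; rewrite big_nbr; apply: lt_le_trans (_ : F (flip (Ordinal n_gt0) x) <= _) => //.
by rewrite (bigD1 (Ordinal n_gt0))//= lerDl sumr_ge0// => i _; exact: ltW.
Qed.

Lemma ptrans_ge0 x y : 0 <= ptrans u beta gv x y.
Proof.
rewrite /ptrans; case: ifP => // _; rewrite divr_ge0 ?expR_ge0//.
by apply: sumr_ge0 => z _; exact: expR_ge0.
Qed.

Lemma reversible_measure_ge0 x : 0 <= reversible_measure x.
Proof. by rewrite divr_ge0// sumr_ge0// => y _; exact: expR_ge0. Qed.

Lemma conductance_pweight x y :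
  conductance x y = expR (- (beta * H x)) * pweight u beta gv x y.
Proof.
rewrite /conductance /pweight -expRD -opprD -mulrDr addr_maxr addr0.
by rewrite addrC subrK maxC.
Qed.

(** Detailed balance: the total conductance at [x] cancels the normalization of [ptrans], and what
    remains is symmetric in [x] and [y]. *)
Lemma reversible_ptrans x y : reversible_measure x * ptrans u beta gv x y =
  if nbr x y then conductance x y / n%:R else 0.
Proof.
rewrite /ptrans; case: ifP => xy; last by rewrite mulr0.
rewrite /reversible_measure; under eq_bigr do rewrite conductance_pweight.
rewrite -mulr_sumr conductance_pweight.
have Z0 : 0 < \sum_(z | nbr x z) pweight u beta gv x z.
  by apply: sum_nbr_gt0 => z; exact: expR_gt0.
by field; rewrite pnatr_eq0 -lt0n n_gt0 lt0r_neq0.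
Qed.

Lemma reversible_measure_invariant y :
  \sum_x reversible_measure x * ptrans u beta gv x y = reversible_measure y.
Proof.
under eq_bigr do rewrite reversible_ptrans.
rewrite -big_mkcond /= /reversible_measure mulr_suml.
apply: eq_big => x; first by rewrite nbr_sym.
by rewrite /conductance maxC.
Qed.

(* An edge touching [Vcirc] has an unoccupied end, where the energy is the maximum 0. *)
Lemma conductance_circ x y : circ x -> nbr x y -> conductance x y = 1.
Proof.
move=> cx xy; suff m0 : Num.max (H x) (H y) = 0 by rewrite /conductance [Num.max _ _]m0 mulr0 oppr0 expR0.
have [ox|ox] := boolP (occupied u gv x); last first.
  have -> : H x = 0 by rewrite /Hn (negbTE ox).
  by apply/max_idPl; exact: Hn_le0.
have oy : ~~ occupied u gv y.
  by apply: contra cx => oy; rewrite /Vstar ox; apply/existsP; exists y; rewrite xy.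
have -> : H y = 0 by rewrite /Hn (negbTE oy).
by apply/max_idPr; exact: Hn_le0.
Qed.

Lemma reversible_measure_circ x : circ x -> reversible_measure x = 1.
Proof.
move=> cx; rewrite /reversible_measure (eq_bigr (fun=> 1)) => [|y xy]; last exact: conductance_circ.
by rewrite big_nbr sumr_const card_ord divff// pnatr_eq0 -lt0n.
Qed.

(** Each vertex of [star] has [n] neighbours, and each edge from [circ] carries flux [kappa / n], so
    a vertex receives at most [kappa]. *)
Lemma flux_le (kappa : R) : 0 <= kappa ->
  \sum_(x | circ x) \sum_(y | star y) kappa * reversible_measure x * ptrans u beta gv x y
  <= kappa * #|star|%:R.
Proof.
move=> k0; rewrite exchange_big /=.
rewrite -sum1_card natr_sum mulr_sumr.
apply: ler_sum => y sy.
under eq_bigr do rewrite -mulrA.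
rewrite -mulr_sumr; apply: ler_wpM2l => //.
apply: (@le_trans _ _ (\sum_(x | nbr y x) n%:R^-1)).
  rewrite [leRHS]big_mkcond [leLHS]big_mkcond /=; apply: ler_sum => x _.
  rewrite reversible_ptrans nbr_sym.
  case: ifPn => cx; case: ifPn => xy //.
  by rewrite conductance_circ ?mul1r// nbr_sym.
by rewrite big_nbr sumr_const card_ord -[_ *+ n]mulr_natr mulVf// pnatr_eq0 -lt0n.
Qed.

Lemma card_circ_star : (#|circ| + #|star| = 2 ^ n)%N.
Proof.
have -> : (2 ^ n = #|{: vertex n}|)%N by rewrite card_ffun card_bool card_ord.
rewrite -(cardC circ); congr addn.
by apply: eq_card => x; rewrite !inE /Vcirc negbK.
Qed.

Lemma kdagger_concentration_landscape {d2 : measure_display}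
    {Omega2 : measurableType d2} (Q : probability Omega2 R)
    (J : nat -> Omega2 -> vertex n) (m : nat) (eps delta : R) :
  is_markov_chain Q J (init_circ u gv) (ptrans u beta gv) ->
  0 < eps -> 0 <= delta <= 1 -> #|star|%:R <= 2 ^+ n * delta / 2 ->
  ((1 - delta / eps)%:E <= Q [set w | forall K, is_Kn circ J m w K ->
     (m <= kdagger circ star J m w K)%N /\
     ((kdagger circ star J m w K)%:R <= (1 + eps) * m%:R)%R])%E.
Proof.
move=> MC eps0 /andP[delta0 delta1] le_star.
have pow_gt0 : 0 < 2 ^+ n :> R by rewrite exprn_gt0.
have card_eq : #|circ|%:R + #|star|%:R = 2 ^+ n :> R.
  by rewrite -natrD card_circ_star natrX.
(* The factor 1/2 in the bound on [star] leaves at least half of the cube to [circ], whence #|star|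
   / #|circ| is at most [delta]. *)
have ge_circ : 2 ^+ n / 2 <= #|circ|%:R :> R.
  have : 2 ^+ n * delta / 2 <= 2 ^+ n / 2 by rewrite ler_pM2r// ler_piMr// ltW.
  lra.
have circ_gt0 : 0 < #|circ|%:R :> R by apply: lt_le_trans ge_circ; lra.
apply: (kdagger_concentration Q J _ _ circ star MC reversible_measure
  (#|circ|%:R^-1) delta) => //.
- exact: ptrans_ge0.
- exact: reversible_measure_ge0.
- exact: reversible_measure_invariant.
- move=> x; rewrite /init_circ card_setE; case: ifPn => // cx.
  by rewrite reversible_measure_circ ?mulr1.
- apply: le_trans (flux_le _ _) _; first by rewrite invr_ge0.
  rewrite mulrC ler_pdivrMr//; apply: le_trans le_star _.
  by rewrite mulrAC mulrC ler_wpM2l.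
Qed.

End landscape.

(** * The environment *)

Lemma flipK {n : nat} (i : 'I_n) : involutive (flip i).
Proof. by move=> x; apply/ffunP => j; rewrite !ffunE addbA addbb. Qed.

(* [0 <= sum (a i - b)^2] *)
Lemma sum_sqr_lt {R : realFieldType} {n : nat} (a : 'I_n -> R) (b : R) : 0 < b ->
  \sum_i a i ^+ 2 < n%:R * b ^+ 2 -> \sum_i a i < n%:R * b.
Proof.
move=> b0 lt_sq.
have : 0 <= \sum_i (a i - b) ^+ 2 by apply: sumr_ge0 => i _; exact: sqr_ge0.
under eq_bigr do rewrite sqrrB.
rewrite big_split sumrB /= sumr_const card_ord -[_ *+ n]mulr_natl.
rewrite (_ : \sum_(i < n) a i * b *+ 2 = 2 * b * \sum_i a i); last first.
  by rewrite mulr_sumr; apply: eq_bigr => i _; rewrite -mulr_natl; ring.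
move=> ge0; rewrite -(@ltr_pM2l _ (2 * b)); last by rewrite mulr_gt0.
have -> : 2 * b * (n%:R * b) = n%:R * b ^+ 2 + n%:R * b ^+ 2 by ring.
lra.
Qed.

(** * Second moments of the number of adjacent occupied pairs *)

Section occupied_pairs.
Context {R : realType} {d : measure_display} {Omega : measurableType d}
  (P : probability Omega R) {n : nat} (O : vertex n -> set Omega) (q : R).
Hypotheses (mO : forall x, measurable (O x)) (q_ge0 : 0 <= q)
  (indep : forall xs : seq (vertex n), uniq xs ->
     P (\bigcap_(x in [set` xs]) O x) = (q ^+ size xs)%:E).

Definition occupied_pair (i : 'I_n) (x : vertex n) : set Omega :=
  O x `&` O (flip i x).

Lemma measurable_occupied_pair i x : measurable (occupied_pair i x).
Proof. exact: measurableI. Qed.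

Lemma prob_occupied_pair i x : P (occupied_pair i x) = (q ^+ 2)%:E.
Proof.
rewrite -(indep [:: x; flip i x]); last by rewrite /= inE eq_sym flip_neq.
congr (P _); apply/seteqP; split=> [w [Ox Ofx] y /=|w Ow].
  by rewrite !inE => /orP[/eqP ->|/eqP ->].
by split; apply: Ow; rewrite /= !inE eqxx ?orbT.
Qed.

(** Distinct edges of the matching in direction [i] are disjoint, so four distinct vertices are
    involved and independence applies. *)
Lemma prob_two_occupied_pairs i x y : y != x -> y != flip i x ->
  P (occupied_pair i x `&` occupied_pair i y) = (q ^+ 4)%:E.
Proof.
move=> yx yfx; rewrite -(indep [:: x; flip i x; y; flip i y]).
  congr (P _); apply/seteqP; split=> [w [[Ox Ofx] [Oy Ofy]] z /=|w Ow].
    by rewrite !inE => /or4P[] /eqP ->.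
  by split; split; apply: Ow; rewrite /= !inE eqxx ?orbT.
rewrite /= !inE !negb_or !andbT [x == _]eq_sym flip_neq [x == y]eq_sym yx /=.
rewrite [flip i x == y]eq_sym yfx (inj_eq (inv_inj (flipK i))) [x == y]eq_sym yx.
by rewrite [y == flip i y]eq_sym flip_neq !andbT -(inj_eq (inv_inj (flipK i))) flipK eq_sym.
Qed.

(** Only [y = x] and [y = flip i x] yield the same edge; each contributes at most [q ^+ 2], all
    others [q ^+ 4]. *)
Lemma second_moment_occupied_pairs i x :
  (\sum_y P (occupied_pair i x `&` occupied_pair i y)
   <= (2 ^+ n * q ^+ 4 + 2 * q ^+ 2)%:E)%E.
Proof.
apply: (@le_trans _ _ (\sum_(y : vertex n)
    (q ^+ 4 + ((y == x)%:R + (y == flip i x)%:R) * q ^+ 2)%:E)%E).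
  apply: lee_sum => y _.
  have [yx|yx] := eqVneq y x; last first.
    have [yfx|yfx] := eqVneq y (flip i x); last first.
      by rewrite prob_two_occupied_pairs// lee_fin lerDl addr0 mul0r.
    apply: (@le_trans _ _ (q ^+ 2)%:E); last by rewrite lee_fin add0r mul1r lerDr exprn_ge0.
    rewrite -(prob_occupied_pair i x); apply: le_measure; rewrite ?inE//.
      by apply: measurableI; exact: measurable_occupied_pair.
    exact: measurable_occupied_pair.
  apply: (@le_trans _ _ (q ^+ 2)%:E).
    rewrite -(prob_occupied_pair i x); apply: le_measure; rewrite ?inE//.
      by apply: measurableI; exact: measurable_occupied_pair.
    exact: measurable_occupied_pair.
  rewrite lee_fin mulrDl mul1r addrCA lerDl.
  by rewrite addr_ge0 ?mulr_ge0 ?exprn_ge0.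
rewrite sumEFin lee_fin big_split /= sumr_const card_ffun card_bool card_ord.
rewrite -mulr_suml big_split /= -!natr_sum -[_ *+ (2 ^ n)]mulr_natl natrX.
rewrite (bigD1 x)//= eqxx big1 => [|y /negbTE -> //].
by rewrite (bigD1 (flip i x))//= eqxx big1 // => y /negbTE ->.
Qed.

(** With N_i the number of [x] whose pair in direction [i] is occupied, the right side is the sum of
    the squares N_i^2, expanded into indicators to suit [markov_indic]. *)
Definition crowded (b : R) : set Omega :=
  [set w | n%:R * b ^+ 2 <= \sum_(k : 'I_n * vertex n * vertex n)
     \1_(occupied_pair k.1.1 k.1.2 `&` occupied_pair k.1.1 k.2) w].

Let measurable_two_pairs (k : 'I_n * vertex n * vertex n) :
  measurable (occupied_pair k.1.1 k.1.2 `&` occupied_pair k.1.1 k.2).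
Proof. by apply: measurableI; exact: measurable_occupied_pair. Qed.

Lemma measurable_crowded b : measurable (crowded b).
Proof.
have b0 : 0 <= n%:R * b ^+ 2 by rewrite mulr_ge0 ?sqr_ge0.
by have [] := markov_indic P _ _ _ measurable_two_pairs b0.
Qed.

(** Let s be the mean of N_i. The expected sum of squares is at most n (s^2 + 2 s), hence at most 3
    n s^2 because s is at least 1; dividing by the level n (s n / 2)^2 gives 12 / n^2. *)
Lemma prob_crowded : (0 < n)%N -> 1 <= 2 ^+ n * q ^+ 2 ->
  (P (crowded (2 ^+ n * q ^+ 2 * n%:R / 2)) <= (12 / n%:R ^+ 2)%:E)%E.
Proof.
move=> n0 le1; set s := 2 ^+ n * q ^+ 2; set b := s * n%:R / 2.
have s1 : 1 <= s by [].
have n0' : 0 < n%:R :> R by rewrite ltr0n.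
have s0 : 0 < s by exact: lt_le_trans le1.
have b0 : 0 < n%:R * b ^+ 2 by rewrite mulr_gt0 ?exprn_gt0// divr_gt0// mulr_gt0.
have [_ mk] := markov_indic P _ _ _ measurable_two_pairs (ltW b0).
rewrite -(@lee_pmul2l _ (n%:R * b ^+ 2)%:E)//; apply: le_trans mk _.
rewrite -(pair_bigA _ (fun ix y => P (occupied_pair ix.1 ix.2 `&` occupied_pair ix.1 y))) /=.
rewrite -(pair_bigA _ (fun i x => \sum_y P (occupied_pair i x `&` occupied_pair i y))%E) /=.
apply: (@le_trans _ _ (\sum_(i < n) \sum_(x : vertex n)
    (2 ^+ n * q ^+ 4 + 2 * q ^+ 2)%:E)%E).
  by apply: lee_sum => i _; apply: lee_sum => x _; exact: second_moment_occupied_pairs.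
under eq_bigr do rewrite sumEFin sumr_const card_ffun card_bool card_ord.
rewrite sumEFin sumr_const card_ord -EFinM lee_fin.
rewrite -[_ *+ n]mulr_natl -[_ *+ (2 ^ n)]mulr_natl natrX.
have -> : n%:R * b ^+ 2 * (12 / n%:R ^+ 2) = 3 * s ^+ 2 * n%:R.
  by rewrite /b; field; rewrite lt0r_neq0.
have -> : n%:R * (2 ^+ n * (2 ^+ n * q ^+ 4 + 2 * q ^+ 2)) =
    n%:R * (s ^+ 2 + 2 * s) by rewrite /s; ring.
rewrite [leRHS]mulrC ler_pM2l//; nra.
Qed.

(** Each vertex of [star] is counted by some N_i, and [sum_sqr_lt] turns the bound on the squares
    into one on the sum of the N_i. *)
Lemma card_occupied_pairs (star : pred (vertex n)) (b : R) w : 0 < b ->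
  (forall x, star x -> exists i, occupied_pair i x w) -> ~ crowded b w ->
  #|star|%:R <= n%:R * b.
Proof.
move=> b0 starP /negP; rewrite -ltNge => lt_sq.
apply: (@le_trans _ _ (\sum_(i < n) \sum_(x : vertex n) \1_(occupied_pair i x) w)).
  rewrite exchange_big -sum1_card natr_sum big_mkcond /=; apply: ler_sum => x _.
  case: ifPn => [/starP[i Oi]|_]; last by rewrite sumr_ge0.
  by rewrite (bigD1 i)//= indicE mem_set// lerDl sumr_ge0.
apply/ltW/sum_sqr_lt => //; apply: le_lt_trans lt_sq.
rewrite -(pair_bigA _ (fun ix y =>
  \1_(occupied_pair ix.1 ix.2 `&` occupied_pair ix.1 y) w)) /=.
rewrite -(pair_bigA _ (fun i x =>
  \sum_y \1_(occupied_pair i x `&` occupied_pair i y) w)) /=.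
apply: ler_sum => i _; rewrite expr2 mulr_suml; apply: ler_sum => x _.
by rewrite mulr_sumr; apply: ler_sum => y _; rewrite indicI.
Qed.

End occupied_pairs.

(** * Gaussian thresholds, independence and numerical estimates *)

Lemma normal_prob_le0 {R : realType} :
  exists2 q : R, 0 < q & (q%:E <= normal_prob 0 1 `]-oo, 0%R])%E.
Proof.
(* The density at -1, its minimum on the unit interval from -1 to 0. *)
pose q : R := normal_peak 1 * expR (- 2^-1).
have q0 : 0 < q by rewrite mulr_gt0 ?expR_gt0// normal_peak_gt0.
exists q => //; rewrite /normal_prob.
have mpdf (D : set R) : measurable_fun D (fun x => (normal_pdf 0 1 x)%:E).
  by apply/measurable_EFinP; apply: measurable_funTS; exact: measurable_normal_pdf.
have pdf0 (x : R) : (0 <= (normal_pdf 0 1 x)%:E)%E by rewrite lee_fin normal_pdf_ge0.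
apply: (@le_trans _ _ (\int[lebesgue_measure]_(x in `[(-1)%R, 0%R]) (normal_pdf 0 1 x)%:E)%E); last first.
  apply: ge0_subset_integral => //=; first exact: mpdf.
  by move=> x /=; rewrite !in_itv /= => /andP[].
apply: (@le_trans _ _ (\int[lebesgue_measure]_(x in `[(-1)%R, 0%R]) (cst q%:E) x)%E).
  rewrite integral_cst//= lebesgue_measure_itv /= lte_fin ltrN10.
  by rewrite -EFinD -EFinM add0r opprK mulr1.
apply: ge0_le_integral => //=.
- by move=> x _; rewrite lee_fin ltW.
- exact: mpdf.
- move=> x; rewrite in_itv /= => /andP[x1 x0].
  rewrite lee_fin normal_pdfE// ler_pM2l ?normal_peak_gt0// ler_expR subr0.
  by rewrite expr1n; nra.
Qed.

Lemma existT_vertex_inj n : injective (fun x : vertex n => existT vertex n x : gindex).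
Proof. by move=> x y xy; exact: existT_inj2 xy. Qed.

Lemma iid_occupied {R : realType} {d : measure_display} {Omega : measurableType d}
    (P : probability Omega R) (g : forall n, vertex n -> Omega -> R)
    (n : nat) (v q : R) : iid_std_gaussian P g ->
  (forall x : vertex n, P [set w | g n x w <= v] = q%:E) ->
  forall xs : seq (vertex n), uniq xs ->
  P (\bigcap_(x in [set` xs]) [set w | g n x w <= v]) = (q ^+ size xs)%:E.
Proof.
move=> [_ indep] Pq xs uxs.
have := indep [seq existT vertex n x | x <- xs].
rewrite (map_inj_uniq (@existT_vertex_inj n)) => /(_ uxs (fun=> `]-oo, v]%classic)) H.
rewrite (_ : \bigcap_(x in _) _ =
    \bigcap_(i in [set` [seq existT vertex n x | x <- xs]])
       (g (projT1 i) (projT2 i) @^-1` `]-oo, v]%classic)); last first.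
  apply/seteqP; split=> [w Ow i /= /mapP[x xxs ->]|w Ow x xxs] /=.
    by rewrite in_itv /=; exact: Ow.
  by have := Ow (existT vertex n x) (map_f _ xxs); rewrite /= in_itv.
rewrite H => [|i]; last exact: measurable_itv.
rewrite big_map; elim: xs {uxs H} => [|x xs IH]; first by rewrite big_nil.
rewrite big_cons IH /= exprS EFinM; congr (_ * _)%E.
by rewrite -(Pq x); congr (P _); apply/seteqP; split=> w /=; rewrite in_itv.
Qed.

(** In logarithms the claim reads 2 c ln n <= n ln 2. Since ln n <= 2 sqrt n, it suffices that sqrt
    n >= 4 c / ln 2, the constant [r] of the proof. *)
Lemma powR_le_exp2 {R : realType} (c : R) : 0 < c ->
  exists N, forall n, (N <= n)%N -> 1 <= 2 ^+ n * (n%:R `^ (- c)) ^+ 2 :> R.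
Proof.
move=> c0; have l2 : 0 < ln 2 :> R by rewrite ln_gt0// ltr1n.
pose r : R := 4 * c / ln 2; exists (Num.truncn (r ^+ 2)).+1 => n Nn.
have n0 : 0 < n%:R :> R by rewrite ltr0n; exact: leq_trans Nn.
have r0 : 0 < r by rewrite divr_gt0// mulr_gt0.
have rn : r <= Num.sqrt n%:R.
  rewrite -(@ler_pXn2r _ 2)// ?nnegrE ?sqrtr_ge0 ?ltW// sqr_sqrtr ?ltW//.
  by apply: lt_le_trans (truncnS_gt _) _; rewrite ler_nat.
have s0 : 0 < Num.sqrt (n%:R : R) by rewrite sqrtr_gt0.
have ln_n : ln (n%:R : R) <= 2 * Num.sqrt n%:R.
  rewrite -[in leLHS](sqr_sqrtr (ltW n0)) lnXn// -[ln _ *+ 2]mulr_natl ler_pM2l//.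
  exact/ltW/ln_sublinear.
have -> : 2 ^+ n = expR (n%:R * ln 2) :> R by rewrite expRM_natl lnK// posrE.
rewrite /powR gt_eqF// -expRM_natl -expRD -[leLHS]expR0 ler_expR.
have h1 : 4 * c <= ln 2 * Num.sqrt n%:R.
  by rewrite [leRHS]mulrC -ler_pdivrMr.
have h2 : n%:R = Num.sqrt n%:R * Num.sqrt n%:R :> R by rewrite -expr2 sqr_sqrtr// ltW.
have h3 : 4 * c * Num.sqrt n%:R <= n%:R * ln 2.
  by rewrite [in leRHS]h2 mulrC -mulrA ler_pM2l// [leRHS]mulrC.
have h4 : c * ln n%:R <= c * (2 * Num.sqrt n%:R) by rewrite ler_pM2l.
lra.
Qed.

Lemma summable_inv_sqr {R : realType} (A : R) (f : nat -> \bar R) :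
  (forall n, 0 <= f n)%E -> (forall n, f n <= (A / n.+1%:R ^+ 2)%:E)%E ->
  (\sum_(0 <= n <oo) f n < +oo)%E.
Proof.
move=> f0 fA.
have A0 : 0 <= A by have := le_trans (f0 0%N) (fA 0%N); rewrite lee_fin expr1n divr1.
apply: (@le_lt_trans _ _ (2 * A)%:E); last exact: ltry.
apply: lime_le; first by apply: is_cvg_nneseries => n _ _; exact: f0.
apply: nearW => n.
(* Telescoping: 1 / m^2 <= 2 / m - 2 / (m + 1) for m >= 1. *)
suff : (\sum_(0 <= k < n) f k <= (2 * A - 2 * A / n.+1%:R)%:E)%E.
  by move=> /le_trans; apply; rewrite lee_fin gerBl divr_ge0// mulr_ge0.
elim: n => [|n IH]; first by rewrite big_nil divr1 subrr.
rewrite big_nat_recr//=; apply: le_trans (leeD IH (fA n)) _.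
rewrite -EFinD lee_fin -[n.+2]addn1 natrD.
have n0 : 0 < n.+1%:R :> R by rewrite ltr0n.
have n1 : 1 <= n.+1%:R :> R by rewrite ler1n.
set m := n.+1%:R in n0 n1 *.
rewrite -subr_ge0 (_ : _ - _ = A * (m - 1) / (m ^+ 2 * (m + 1))).
  by rewrite divr_ge0 ?mulr_ge0 ?exprn_ge0 ?subr_ge0 ?addr_ge0// ltW.
by field; rewrite !lt0r_neq0// addr_gt0.
Qed.

Lemma measurable_gaussian_le {R : realType} {d : measure_display}
    {Omega : measurableType d} (P : probability Omega R) (X : Omega -> R) (v : R) :
  std_gaussian P X -> measurable [set w | X w <= v].
Proof.
move=> [mX _]; rewrite (_ : [set _ | _] = setT `&` X @^-1` `]-oo, v]%classic).
  by apply: mX => //; exact: measurable_itv.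
by rewrite setTI; apply/seteqP; split=> w /=; rewrite in_itv.
Qed.

(** A negative [u n] would make the occupation probability at least that of a nonpositive Gaussian,
    a positive constant, while it is at most 1 / n. *)
Lemma threshold_ge0 {R : realType} {d : measure_display} {Omega : measurableType d}
    (P : probability Omega R) (g : forall n, vertex n -> Omega -> R) (c : R)
    (u : nat -> R) : iid_std_gaussian P g -> 1 <= c ->
  (forall n : nat, (1 < n)%N -> forall x : vertex n,
     P [set w | g n x w <= - u n] = ((n%:R) `^ (- c))%:E) ->
  exists N, forall n, (N <= n)%N -> 0 <= u n.
Proof.
move=> [gaussian _] c1 Pu; have [q q0 q_le] := @normal_prob_le0 R.
exists (Num.truncn q^-1).+2 => n Nn; rewrite leNgt; apply/negP => un.
have n_gt1 : (1 < n)%N by exact: leq_trans Nn.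
have n1 : 1 <= n%:R :> R by rewrite ler1n ltnW.
pose x : vertex n := [ffun=> true].
have [mX law] := gaussian n x.
have : (q%:E <= (n%:R `^ (- c))%:E)%E.
  apply: le_trans q_le _; rewrite -law; last exact: measurable_itv.
  rewrite -(Pu n n_gt1 x); apply: le_measure; rewrite ?inE//.
  - by rewrite -[X in measurable X]setTI; apply: mX => //; exact: measurable_itv.
  - exact: measurable_gaussian_le (gaussian n x).
  - move=> w /=; rewrite in_itv /= => /le_trans; apply.
    by rewrite oppr_ge0 ltW.
rewrite lee_fin; apply/negP; rewrite -ltNge.
apply: (@le_lt_trans _ _ (n%:R `^ (- 1))).
  by apply: ler_powR => //; rewrite lerN2.
rewrite powRN powRr1 ?ler0n// invf_plt ?posrE ?ltr0n//; last exact: ltnW.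
by apply: lt_le_trans (truncnS_gt _) _; rewrite ler_nat ltnW.
Qed.

(** * Borel-Cantelli in the environment, and the conclusion *)

Theorem theorem3p1 (R : realType) (d : measure_display) (Omega : measurableType d)
  (P : probability Omega R) (g : forall n, vertex n -> Omega -> R)
  (cstar beta : R) (u : nat -> R) :
  iid_std_gaussian P g -> 0 < beta -> 2 < cstar ->
  (forall n : nat, (1 < n)%N -> forall x : vertex n,
     P [set w | g n x w <= - u n] = ((n%:R) `^ (- cstar))%:E) ->
  exists Omega' : set Omega, measurable Omega' /\ P Omega' = 1%E /\
  forall (t ccirc : R) (a : nat -> R), 0 < t -> 0 < ccirc -> (forall n, 0 < a n) ->
  exists C : R, forall w, Omega' w ->
  exists N : nat, forall n : nat, (N <= n)%N ->
    let gv := fun x : vertex n => g n x w in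
    let kcirc := Num.truncn (a n * t) in
    forall (d2 : measure_display) (Omega2 : measurableType d2)
           (Q : probability Omega2 R) (J : nat -> Omega2 -> vertex n),
    is_markov_chain Q J (init_circ (u n) gv) (ptrans (u n) beta gv) ->
    ((1 - (n%:R) `^ (- 2 * (cstar - 1) + ccirc)
          * (1 + C * (n%:R) `^ (- (cstar - 1))))%:E
     <= Q [set w2 | forall K : nat,
             is_Kn (Vcirc (u n) gv) J kcirc w2 K ->
             (kcirc <= kdagger (Vcirc (u n) gv) (Vstar (u n) gv) J kcirc w2 K)%N /\
             ((kdagger (Vcirc (u n) gv) (Vstar (u n) gv) J kcirc w2 K)%:R
               <= (1 + (n%:R) `^ (- ccirc)) * kcirc%:R)%R])%E.
Proof.
move=> iid beta0 c2 Pu.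
have c1 : 1 <= cstar by lra.
have c0 : 0 < cstar by lra.
have [N1 u_ge0] := threshold_ge0 P g cstar u iid c1 Pu.
have [N2 pow_le] := powR_le_exp2 cstar c0.
(* From [N0] on, the law of occupation is prescribed (2), [u n] is nonnegative ([N1]) and the mean
   pair count is at least 1 ([N2]). Shifting by [N0] makes the bound on [F k] hold for every [k]. *)
pose N0 := (maxn 2 (maxn N1 N2)).
pose q n : R := n%:R `^ (- cstar).
pose O n (x : vertex n) := [set w | g n x w <= - u n].
have mO n x : measurable (O n x).
  by apply: measurable_gaussian_le; exact: (proj1 iid).
have indep n : (1 < n)%N -> forall xs : seq (vertex n), uniq xs ->
    P (\bigcap_(x in [set` xs]) O n x) = (q n ^+ size xs)%:E.
  by move=> n1; apply: iid_occupied => //; exact: Pu.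
pose b n : R := 2 ^+ n * q n ^+ 2 * n%:R / 2.
pose F k := crowded (O (k + N0)%N) (b (k + N0)%N).
have mF k : measurable (F k) by apply: measurable_crowded.
have PF k : (P (F k) <= (12 / k.+1%:R ^+ 2)%:E)%E.
  have kN0 : (N0 <= k + N0)%N by rewrite leq_addl.
  have k2 : (2 <= k + N0)%N by apply: leq_trans kN0; rewrite leq_maxl.
  have kN2 : (N2 <= k + N0)%N by apply: leq_trans kN0; rewrite !leq_max leqnn !orbT.
  apply: le_trans (prob_crowded P (O (k + N0)%N) (q (k + N0)%N) _ _ _ _ _) _ => //.
  - exact: powR_ge0.
  - exact: indep.
  - exact: ltnW.
  - exact: pow_le.
  (* Since [N0] is at least 1, [k + N0] dominates [k.+1]. *)
  rewrite lee_fin ler_pM2l// lef_pV2 ?posrE ?exprn_gt0 ?ltr0n//; last by exact: ltnW.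
  rewrite ler_pXn2r ?nnegrE// ler_nat -addn1 leq_add2l.
  by apply: leq_trans (leq_maxl _ _).
have F_lim0 : P (lim_sup_set F) = 0%E.
  by apply: lim_sup_set_cvg0 => //; apply: (summable_inv_sqr 12).
have mlim : measurable (lim_sup_set F).
  apply: bigcapT_measurable => k; exact: bigcup_measurable.
exists (~` lim_sup_set F); split; first exact: measurableC.
split; first by rewrite probability_setC// F_lim0 sube0.
(* The event was built from the environment alone, before [t], [ccirc] and [a] are introduced. *)
move=> t ccirc a t0 cc0 a0; exists 0 => w nw.
have [k0 notF] : exists k0, forall k, (k0 <= k)%N -> ~ F k w.
  apply: contrapT => H; apply: nw => k _.
  apply: contrapT => H'; apply: H; exists k => j kj Fj; apply: H'.
  by exists j.
exists (k0 + N0)%N => n Nn gv kcirc d2 Omega2 Q J MC.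
have N0n : (N0 <= n)%N by apply: leq_trans Nn; rewrite leq_addl.
have n2 : (1 < n)%N by apply: leq_trans N0n; rewrite leq_maxl.
have n0 : (0 < n)%N by exact: ltnW.
have un : 0 <= u n by apply: u_ge0; apply: leq_trans N0n; rewrite !leq_max leqnn !orbT.
have nR0 : 0 < n%:R :> R by rewrite ltr0n.
have not_crowded : ~ crowded (O n) (b n) w.
  have := notF (n - N0)%N; rewrite /F subnK//; apply.
  by rewrite leq_subRL// addnC.
(* Equals n^2 times [q n ^+ 2], so [n%:R * b n] is exactly [2 ^+ n * delta / 2]; dividing by eps =
   n^(-ccirc) yields the error term of the claim. *)
pose delta : R := n%:R `^ (- 2 * (cstar - 1)).
have deltaE : delta = n%:R ^+ 2 * q n ^+ 2.
  rewrite /delta /q (_ : - 2 * (cstar - 1) = 2 + (- cstar) * 2); last by ring.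
  rewrite powRD; last by rewrite (gt_eqF nR0) implybT.
  by rewrite powRrM !powR_mulrn// powR_ge0.
rewrite mul0r addr0 mulr1.
rewrite (_ : n%:R `^ (- 2 * (cstar - 1) + ccirc) = delta / n%:R `^ (- ccirc)); last first.
  rewrite powRD; last by rewrite (gt_eqF nR0) implybT.
  by rewrite powRN invrK.
apply: kdagger_concentration_landscape => //.
- exact: MC.
- exact: powR_gt0.
- rewrite powR_ge0 /= -[leRHS](powRr0 n%:R); apply: ler_powR; last lra.
  by rewrite ler1n.
- have -> : 2 ^+ n * delta / 2 = n%:R * b n by rewrite deltaE /b; ring.
  apply: card_occupied_pairs not_crowded.
    by rewrite /b divr_gt0// !mulr_gt0 ?exprn_gt0// powR_gt0.
  move=> x /andP[ox /existsP[y /andP[/nbrP[i ->] oy]]].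
  by exists i.
Qed.
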